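(* For $\alpha\in(0,1)$, let $T_\star=T_\star(\alpha)$ be the blow-up time of the solution $v$ of ${}^C D^\alpha_{0,+}v(t)=v^2(t)$, $v(0)=1$ (equivalently, of the solution $u(x,t)=-x\,v(t)$ of the time-fractional Burgers' equation ${}^C D^\alpha_{0,+}u+u\,\partial_x u=0$ with $u(x,0)=-x$), as defined in the context. Then for any $\delta>0$ there exists $c_\delta>0$, depending only on $\delta$, such that for all $\alpha\in(0,1)$ $$T_\star\ge\frac{c_\delta^{\frac{1-\alpha}{\alpha}}}{1+\delta}\left(\frac{1}{\Gamma(2-\alpha)}\right)^{1/\alpha}.$$
   Context: $\Gamma$ is the Euler Gamma function. For $\alpha\in(0,1)$, the left-Caputo-derivative with initial time $0$ is $${}^C D^\alpha_{0,+} f(t):=\frac{1}{\Gamma(1-\alpha)}\int_0^t\frac{\dot f(\tau)}{(t-\tau)^\alpha}\,d\tau,\qquad t>0.$$ Definition of $v$ and $T_\star$. For each integer $M\ge4$ let $f_M(r):=\min\{r^2,M^2\}$, $r\in\mathbb{R}$, and let $v_M:[0,+\infty)\to\mathbb{R}$ be the unique continuous solution of the Cauchy problem ${}^C D^\alpha_{0,+}v_M(t)=f_M(v_M(t))$ for $t>0$, $v_M(0)=1$, understood in the equivalent Volterra form $$v_M(t)=1+\frac{1}{\Gamma(\alpha)}\int_0^t\frac{f_M(v_M(\tau))}{(t-\tau)^{1-\alpha}}\,d\tau,\qquad t\ge0.$$ The functions $v_M$ are nondecreasing in $M$; set $v(t):=\lim_{M\to+\infty}v_M(t)=\sup_{M\ge4}v_M(t)\in[1,+\infty]$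 for $t\ge0$. The blow-up time $T_\star\in(0,+\infty]$ is the largest value such that $\sup_{t\in[0,T_0]}v(t)<+\infty$ for all $T_0\in(0,T_\star)$. On $[0,T_\star)$ the function $v$ is the continuous solution of ${}^C D^\alpha_{0,+}v(t)=v^2(t)$, $v(0)=1$, that is, $$v(t)=1+\frac{1}{\Gamma(\alpha)}\int_0^t\frac{v^2(\tau)}{(t-\tau)^{1-\alpha}}\,d\tau,\qquad t\in[0,T_\star).$$ *)

(* Defs.v *)
From HB Require Import structures.
From mathcomp Require Import all_boot all_order all_algebra.
From mathcomp Require Import all_classical all_reals all_analysis.

Set Implicit Arguments.
Unset Strict Implicit.
Unset Printing Implicit Defensive.

Import Order.TTheory GRing.Theory Num.Theory.
Import numFieldNormedType.Exports.

Local Open Scope classical_set_scope.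
Local Open Scope ring_scope.

(* Meaningful for a > 0, where the integral converges. *)
Definition Gamma (R : realType) (a : R) : R :=
  \int[lebesgue_measure]_(x in `]0, +oo[%classic) (x `^ (a - 1) * expR (- x)).

Definition trunc_sq (R : realType) (M : nat) (r : R) : R :=
  Num.min (r ^+ 2) (M%:R ^+ 2).

(* Volterra form of the Caputo problem D^alpha w = f_M(w), w(0) = 1.  At the
   endpoint tau = t the kernel takes a junk value, which does not affect the
   Lebesgue integral.  Values of w on negative times are irrelevant. *)
Definition is_trunc_solution (R : realType) (alpha : R) (M : nat) (w : R -> R)
    : Prop :=
  {within `[0, +oo[%classic, continuous w} /\
  forall t : R, 0 <= t ->
    w t = 1 + (Gamma alpha)^-1 *
      \int[lebesgue_measure]_(tau in `[0, t]%classic)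
        (trunc_sq M (w tau) / (t - tau) `^ (1 - alpha)).

Definition sup_solution (R : realType) (w : nat -> R -> R) (t : R) : \bar R :=
  ereal_sup [set (w M t)%:E | M in [set M : nat | (4 <= M)%N]].

Definition blowup_time (R : realType) (v : R -> \bar R) : \bar R :=
  ereal_sup [set T : \bar R | (0 < T)%E /\
    forall T0 : R, 0 < T0 -> (T0%:E < T)%E ->
      (ereal_sup [set v t | t in [set t : R | (0 <= t <= T0)%R]] < +oo)%E].

(* Main.v *)
Require Import Defs.
From HB Require Import structures.
From mathcomp Require Import all_boot all_order all_algebra.
From mathcomp Require Import all_classical all_reals all_analysis.
From mathcomp Require Import measurable_realfun ring lra.

Set Implicit Arguments.
Unset Strict Implicit.

Import Order.TTheory GRing.Theory Num.Theory.
Import numFieldNormedType.Exports.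

Local Open Scope classical_set_scope.
Local Open Scope ring_scope.

(** A strict supersolution of the Volterra equation bounds every truncated
    solution, hence bounds the blow-up time from below. For [alpha] near 1 take
    [1 / (1 - rho - t)], with [rho] of the order of [delta]: its square
    integrates to [1 / (1 - rho - t) - 1 / (1 - rho)], which leaves a uniform
    slack [1 / (1 - rho) - 1] to absorb the difference between the kernel and 1.
    For the other [alpha] the constant 2 is a supersolution up to a time
    [const ^ (1 / alpha)], and [c] can be chosen so small that
    [c ^ ((1 - alpha) / alpha)] beats this constant. *)

Section integrals.
Context {R : realType}.
Local Notation mu := (@lebesgue_measure R).

(** * Integration through primitives on closed and half-open intervals *)

Lemma integral_itvcc_derive (f F : R -> R) (a b : R) : a <= b ->
  (forall x, a <= x <= b -> is_derive x 1 F (f x)) ->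
  (forall x, a <= x <= b -> derivable f x 1) ->
  (\int[mu]_(x in `[a, b]) (f x)%:E = (F b - F a)%:E)%E.
Proof.
rewrite le_eqVlt => /predU1P[<- _ _|ab dF df].
  by rewrite set_itv1 integral_set1 subrr.
have cF : {within `[a, b], continuous F}.
  apply: derivable_within_continuous => x; rewrite in_itv /= => /dF dFx.
  exact: ex_derive.
rewrite (@continuous_FTC2 _ f F) ?EFinB//.
- by apply: derivable_within_continuous => x; rewrite in_itv /= => /df.
- have [cF1 cF2 cF3] := (continuous_within_itvP _ ab).1 cF.
  split=> // x; rewrite in_itv /= => /andP[ax xb].
  by have := dF x; rewrite !ltW// => /(_ isT) dFx; exact: ex_derive.
- move=> x; rewrite in_itv /= => /andP[ax xb]; rewrite derive1E.
  by have := dF x; rewrite !ltW// => /(_ isT) dFx; exact: derive_val.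
Qed.

(** Made for kernels singular at the right endpoint: the closed intervals [[a, d n]] exhaust [[a,
    b[], monotone convergence passes to the limit, and [L] stands in for the value of [F] at [b]. *)
Lemma integral_itvco_derive_le (f F : R -> R) (a b L : R) : a <= b ->
  (forall x, a <= x < b -> is_derive x 1 F (f x)) ->
  (forall x, a <= x < b -> derivable f x 1) ->
  (forall x, a <= x < b -> 0 <= f x) ->
  (forall x, a <= x <= b -> F x <= L) ->
  (\int[mu]_(x in `[a, b[) (f x)%:E <= (L - F a)%:E)%E.
Proof.
move=> ab dF df f0 FL.
pose d n := b - (b - a) / n.+1%:R.
have dab n : a <= d n.
  by rewrite /d lerBrDr -lerBrDl ler_pdivrMr// ler_peMr ?subr_ge0// ler1n.
have db n : a < b -> d n < b.
  by move=> altb; rewrite /d ltrBlDr ltrDl divr_gt0// subr_gt0.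
move: ab; rewrite le_eqVlt => /predU1P[ab|ab].
  by rewrite -ab set_itvco0 integral_set0 lee_fin subr_ge0 FL// -ab lexx.
have mf : measurable_fun `[a, b[ f.
  apply: subspace_continuous_measurable_fun => //.
  by apply: derivable_within_continuous => x; rewrite in_itv /= => /df.
have sub n : `[a, d n]%classic `<=` `[a, b[%classic.
  by move=> x /=; rewrite !in_itv /= => /andP[-> /= /le_lt_trans]; apply; exact: db.
have -> : `[a, b[%classic = \bigcup_n `[a, d n]%classic.
  apply/seteqP; split => [x /=|x [n _] /sub//].
  rewrite in_itv /= => /andP[ax xb].
  have xb0 : 0 < b - x by rewrite subr_gt0.
  have ba0 : 0 < b - a by rewrite subr_gt0.
  have [n] := ltr_add_invr (divr_gt0 xb0 ba0).
  rewrite add0r ltr_pdivlMr// => nx; exists n => //=; rewrite in_itv /= ax /=.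
  by rewrite /d lerBrDr -lerBrDl mulrC ltW.
have cvf : (\int[mu]_(x in `[a, d n]) (f x)%:E)%E @[n --> \oo] -->
    (\int[mu]_(x in \bigcup_n `[a, d n]%classic) (f x)%:E)%E.
  apply: ge0_nondecreasing_set_cvg_integral => [n m nm|n|n|n x /sub].
  - apply/subsetPset => x /=; rewrite !in_itv /= => /andP[-> /= /le_trans]; apply.
    by rewrite /d lerB// ler_wpM2l ?subr_ge0 ?(ltW ab)// lef_pV2 ?posrE// ler_nat.
  - exact: measurable_itv.
  - by apply/measurable_EFinP; exact: measurable_funS mf.
  - by rewrite /= in_itv lee_fin => /f0.
apply: (cvge_le _ cvf); apply: nearW => n.
have itvd x : a <= x <= d n -> a <= x < b.
  by move=> /andP[-> /le_lt_trans]; apply; exact: db.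
rewrite (integral_itvcc_derive (dab n) (fun x xd => dF x (itvd x xd))
  (fun x xd => df x (itvd x xd))).
by rewrite lee_fin lerB// FL// dab ltW// db.
Qed.

(** * Upper bounds for the inverse of [Gamma] *)

Lemma measurable_Gamma_integrand (a : R) :
  measurable_fun setT (fun x : R => x `^ (a - 1) * expR (- x)).
Proof.
apply: measurable_funM; first exact: measurable_powR.
apply: (@measurableT_comp _ _ _ _ _ _ _ _ (fun x : R => - x)).
  exact: measurable_expR.
exact: measurable_funN.
Qed.

Lemma Gamma_ge0 (a : R) : 0 <= Gamma a.
Proof.
by apply: Rintegral_ge0 => x _; rewrite mulr_ge0 ?powR_ge0 ?expR_ge0.
Qed.

(* Should the integral diverge, [Gamma a] would be the junk value 0, whose
   inverse is 0; so no integrability is needed here. *)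
Lemma Gamma_inv_le (a p q : R) (f F : R -> R) : 0 <= p -> p <= q ->
  (forall x, p <= x <= q -> is_derive x 1 F (f x)) ->
  (forall x, p <= x <= q -> derivable f x 1) ->
  (forall x, p < x <= q -> 0 <= f x <= x `^ (a - 1) * expR (- x)) ->
  0 < F q - F p -> (Gamma a)^-1 <= (F q - F p)^-1.
Proof.
move=> p0 pq dF df fle Fpq.
have g0 (x : R) : (0 <= (x `^ (a - 1) * expR (- x))%:E)%E.
  by rewrite lee_fin mulr_ge0 ?powR_ge0 ?expR_ge0.
have mg D : measurable D ->
    measurable_fun D (fun x : R => (x `^ (a - 1) * expR (- x))%:E).
  move=> mD; apply/measurable_EFinP; apply: (measurable_funS measurableT) => //.
  exact: measurable_Gamma_integrand.
have mf : measurable_fun `[p, q] f.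
  apply: subspace_continuous_measurable_fun => //.
  by apply: derivable_within_continuous => x; rewrite in_itv /= => /df.
have mf' : measurable_fun `]p, q] (EFin \o f).
  apply/measurable_EFinP; apply: measurable_funS mf => //.
  by apply: subset_itvr; rewrite bnd_simp.
pose I : set R := `]0, +oo[%classic.
have : ((F q - F p)%:E <=
    \int[mu]_(x in I) (x `^ (a - 1) * expR (- x))%:E)%E.
  rewrite -(integral_itvcc_derive pq dF df) -integral_itv_obnd_cbnd//.
  apply: (@le_trans _ _
      (\int[mu]_(x in `]p, q]) (x `^ (a - 1) * expR (- x))%:E)%E).
    apply: ge0_le_integral => //.
    - by move=> x; rewrite /= in_itv lee_fin => /fle/andP[].
    - exact: mg.
    - by move=> x; rewrite /= in_itv lee_fin => /fle/andP[].
  have mI : measurable I by exact: measurable_itv.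
  apply: ge0_subset_integral => //; first exact: (mg I mI).
  move=> x; rewrite /I /= !in_itv /= andbT => /andP[px _].
  exact: le_lt_trans px.
rewrite /Gamma /Rintegral.
case: (\int[mu]_(x in _) _)%E => [r|_|]/=; last by rewrite leeNy_eq.
  2: by rewrite invr0 invr_ge0 ltW.
by rewrite lee_fin => Fr; rewrite lef_pV2 ?posrE// (lt_le_trans Fpq).
Qed.

(* [x `^ (a - 1)] lies above its tangent at 1, and [(1 - a)^-1] is the endpoint
   at which the tangent times [expR (- x)] has integral exactly 1. *)
Lemma Gamma_inv_le1 (a : R) : 0 < a -> a < 1 -> (Gamma a)^-1 <= 1.
Proof.
move=> a0 a1; have b0 : 0 < 1 - a by rewrite subr_gt0.
pose F x : R := expR (- x) * ((1 - a) * x - 1).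
pose f x : R := expR (- x) * (1 + (1 - a) * (1 - x)).
have e : F (1 - a)^-1 - F 0 = 1.
  rewrite /F mulfV ?gt_eqF// subrr !mulr0 oppr0 expR0; lra.
rewrite -[leRHS]invr1 -e.
have dE (x : R) : is_derive x 1 (fun x : R => expR (- x)) (- expR (- x)).
  rewrite -mulrN1.
  exact: is_derive1_comp (is_derive_expR (- x)) (is_deriveNid x 1).
apply: (@Gamma_inv_le a 0 (1 - a)^-1 f F) => //.
- by rewrite invr_ge0 ltW.
- move=> x _; rewrite /F; apply: is_derive_eq.
  rewrite /f /GRing.scale /=; ring.
- move=> x /andP[x0 xb].
  have h : 0 <= 1 + (1 - a) * (1 - x).
    have : (1 - a) * x <= 1 by rewrite mulrC -ler_pdivlMr// div1r.
    lra.
  rewrite /f mulr_ge0 ?expR_ge0//= mulrC ler_wpM2r ?expR_ge0//.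
  rewrite /powR gt_eqF//; apply: le_trans (expR_ge1Dx _).
  have : (1 - a) * ln x <= (1 - a) * (x - 1).
    rewrite ler_wpM2l ?(ltW b0)//.
    by have := @le_ln1Dx R (x - 1); rewrite subrKC; apply; lra.
  lra.
- by rewrite e.
Qed.

(** On [[p, 1]] the exponential is at least [expR (- 1)], and x^(a - 1) integrates there to 1 / (2
    a). The factor [a] will cancel the 1 / alpha produced by integrating the kernel. *)
Lemma Gamma_inv_le_linear (a : R) : 0 < a -> (Gamma a)^-1 <= 2 * expR 1 * a.
Proof.
move=> a0.
pose p : R := 2^-1 `^ a^-1. (* so that [p `^ a = 1 / 2] *)
have p0 : 0 < p by rewrite powR_gt0.
have p1 : p <= 1.
  have <- : 1 `^ a^-1 = 1 :> R by rewrite powR1.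
  by rewrite ge0_ler_powR ?invr_ge0 ?ltW// ?nnegrE; lra.
pose F (x : R) := (expR (- 1) / a) *: (x `^ a).
pose f (x : R) := expR (- 1) *: (x `^ (a - 1)).
have e : F 1 - F p = (2 * expR 1 * a)^-1.
  rewrite /F powR1 -powRrM mulVf ?gt_eqF// powRr1// expRN /GRing.scale /=.
  by field; rewrite !gt_eqF// expR_gt0.
rewrite -[leRHS]invrK -e; apply: (@Gamma_inv_le a p 1 f F) => //.
- exact: ltW.
- move=> x /andP[px _]; have x0 := lt_le_trans p0 px.
  have dx := is_derive1_powR a x0.
  rewrite /F; apply: is_derive_eq; rewrite /f /GRing.scale /=; field.
  by rewrite gt_eqF.
- move=> x /andP[px _]; have x0 := lt_le_trans p0 px.
  have dx := is_derive1_powR (a - 1) x0.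
  by rewrite /f; apply: derivableZ; exact: ex_derive.
- move=> x /andP[px x1]; rewrite /f /GRing.scale /=.
  rewrite mulr_ge0 ?expR_ge0 ?powR_ge0//= mulrC ler_wpM2l ?powR_ge0//.
  by rewrite ler_expR lerN2.
- by rewrite e invr_gt0 !mulr_gt0// expR_gt0.
Qed.

(** Between [e] and [e^-1] the power is at least e^(a - 1), while the exponential integrates to
    exp(-e) - exp(-1/e), at least (1 - e) - e. It serves for a = 2 - alpha, where the factor e^(1 -
    alpha) has the shape that c^(1 - alpha) can absorb. *)
Lemma Gamma_inv_le_powR (a e : R) : 1 <= a -> 0 < e -> e < 2^-1 ->
  (Gamma a)^-1 <= (e `^ (a - 1) * (1 - 2 * e))^-1.
Proof.
move=> a1 e0 e2.
pose F (x : R) := (- e `^ (a - 1)) *: expR (- x).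
pose f (x : R) := (e `^ (a - 1)) *: expR (- x).
have eV : e <= e^-1.
  rewrite -[leRHS]div1r ler_pdivlMr//.
  suff : e * e <= 2^-1 * 2^-1 by lra.
  by apply: ler_pM => //; exact: ltW.
have Fe : e `^ (a - 1) * (1 - 2 * e) <= F e^-1 - F e.
  have -> : F e^-1 - F e = e `^ (a - 1) * (expR (- e) - expR (- e^-1)).
    by rewrite /F /GRing.scale /=; ring.
  rewrite ler_wpM2l ?powR_ge0//.
  have h1 := expR_ge1Dx (- e).
  have h2 : expR (- e^-1) <= e.
    rewrite expRN -[leRHS]invrK lef_pV2 ?posrE ?invr_gt0 ?expR_gt0//.
    by apply: le_trans (expR_ge1Dx _); rewrite lerDr.
  lra.
have F0 : 0 < e `^ (a - 1) * (1 - 2 * e).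
  by rewrite mulr_gt0 ?powR_gt0//; lra.
apply: (@le_trans _ _ (F e^-1 - F e)^-1); last first.
  by rewrite lef_pV2 ?posrE// (lt_le_trans F0).
have dE (x : R) : is_derive x 1 (fun x : R => expR (- x)) (- expR (- x)).
  rewrite -mulrN1.
  exact: is_derive1_comp (is_derive_expR (- x)) (is_deriveNid x 1).
apply: (@Gamma_inv_le a e e^-1 f F) => //.
- exact: ltW.
- by move=> x _; rewrite /F; apply: is_derive_eq; rewrite /f /GRing.scale /= mulrNN.
- move=> x /andP[ex _]; rewrite /f /GRing.scale /=.
  rewrite mulr_ge0 ?expR_ge0 ?powR_ge0//= ler_wpM2r ?expR_ge0//.
  apply: ge0_ler_powR; rewrite ?subr_ge0 ?nnegrE ?(ltW e0) ?(ltW ex)//.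
  exact: ltW (lt_trans e0 ex).
- exact: lt_le_trans Fe.
Qed.

(** * Comparison of truncated solutions with strict supersolutions *)

Lemma measurable_kernel (alpha t : R) (g : R -> R) :
  measurable_fun `[0, t[ g ->
  measurable_fun `[0, t[ (fun tau => g tau / (t - tau) `^ (1 - alpha)).
Proof.
move=> mg.
have -> : (fun tau => g tau / (t - tau) `^ (1 - alpha)) =
    (fun tau => g tau * (t - tau) `^ (- (1 - alpha))).
  by apply/funext => x; rewrite powRN.
apply: measurable_funM => //.
apply: (measurableT_comp (measurable_powR _)).
by apply: measurable_funB => //; exact: measurable_id.
Qed.

Lemma trunc_sq_ge0 (M : nat) (r : R) : 0 <= trunc_sq M r.
Proof. by rewrite /trunc_sq le_min !sqr_ge0. Qed.

Lemma trunc_solution_ge1 (alpha : R) (M : nat) (w : R -> R) (t : R) :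
  is_trunc_solution alpha M w -> 0 <= t -> 1 <= w t.
Proof.
move=> [_ we] t0; rewrite we// lerDl mulr_ge0 ?invr_ge0 ?Gamma_ge0//.
by apply: Rintegral_ge0 => x _; rewrite divr_ge0 ?trunc_sq_ge0 ?powR_ge0.
Qed.

(** The integral of [psi] is bounded in the extended reals, hence finite. At a first meeting point
    it dominates the integral for [w], so the [fine] hidden in the Volterra equation returns the
    true value and not a default one. *)
Lemma trunc_solution_lt (alpha T : R) (M : nat) (w psi : R -> R) :
  is_trunc_solution alpha M w ->
  {within `[0, T], continuous psi} ->
  (forall t, 0 <= t <= T -> exists2 b : R,
    (\int[mu]_(tau in `[0%R, t[)
      (psi tau ^+ 2 / (t - tau) `^ (1 - alpha))%:E <= b%:E)%E &
    1 + (Gamma alpha)^-1 * b < psi t) ->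
  forall t, 0 <= t <= T -> w t < psi t.
Proof.
move=> ws cpsi hb t1 /andP[t10 t1T]; rewrite ltNge; apply/negP => psiw1.
have [cw we] := ws.
pose A := [set t | 0 <= t <= T /\ psi t <= w t].
have A1 : A t1 by split=> //; rewrite t10.
have lbA : lbound A 0 by move=> x [/andP[]].
have hA : has_inf A by split; [exists t1|exists 0].
(* The two functions first meet at [t0]; up to then [w] is below [psi], which
   the Volterra equation turns into [w t0 < psi t0]. *)
pose t0 := inf A.
have t00 : 0 <= t0 by apply: lb_le_inf => //; exists t1.
have t0A x : A x -> t0 <= x by move=> Ax; apply: ge_inf => //; exists 0.
have t0T : t0 <= T by apply: le_trans (t0A _ A1) t1T.
(* The infimum is attained: otherwise continuity would keep [psi] above [w] near [t0], where [A] has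
   points. *)
have psiw0 : psi t0 <= w t0.
  rewrite leNgt; apply/negP => wpsi0.
  have cw' : {within `[0, T], continuous w}.
    by apply: continuous_subspaceW cw; apply: subset_itvl.
  have t0in : `[0, T]%classic t0 by rewrite /= in_itv /= t00.
  have : psi x - w x @[x --> within `[0, T]%classic (nbhs t0)] --> psi t0 - w t0.
    by apply: cvgB; [exact: (subspace_continuousP _ _).1 cpsi _ t0in|
                     exact: (subspace_continuousP _ _).1 cw' _ t0in].
  move=> /cvgr_gt/(_ 0); rewrite subr_gt0 => /(_ wpsi0).
  rewrite near_withinE => /nbhs_ballP[e /= e0 eP].
  have [s [sT sw] ste] := inf_adherent e0 hA.
  have : 0 < psi s - w s.
    apply: eP; last by rewrite /= in_itv.
    rewrite /ball /= ler0_norm ?subr_le0 ?t0A// opprB ltrBlDl.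
    exact: ste.
  by rewrite subr_gt0 ltNge sw.
have [|b ib] := hb t0; first by rewrite t00.
rewrite ltNge => /negP; apply; apply: (le_trans psiw0).
rewrite we// lerD2l ler_wpM2l ?invr_ge0 ?Gamma_ge0//.
have mw : measurable_fun `[0, t0[ w.
  apply: subspace_continuous_measurable_fun => //.
  apply: continuous_subspaceW cw.
  by move=> x; rewrite /= !in_itv /= andbT => /andP[].
have mpsi : measurable_fun `[0, t0[ psi.
  apply: subspace_continuous_measurable_fun => //.
  apply: continuous_subspaceW cpsi.
  by move=> x; rewrite /= !in_itv /= => /andP[-> /ltW /le_trans]; apply.
have mk : measurable_fun `[0, t0[
    (fun tau => (trunc_sq M (w tau) / (t0 - tau) `^ (1 - alpha))%:E).
  apply/measurable_EFinP.
  apply: (@measurable_kernel alpha t0 (fun tau => trunc_sq M (w tau))).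
  have h : measurable_fun `[0, t0[ (fun x : R => (M%:R ^+ 2 : R)).
    exact: measurable_cst.
  exact: (measurable_minr (measurable_funX 2 mw) h).
(* Dropping the endpoint, a null set, leaves only times before [t0], where [w] is at most [psi]. *)
rewrite /Rintegral -integral_itv_bndo_bndc//.
set I := (X in fine X); suff: (0 <= I <= b%:E)%E.
  by case: I => [r| |] /andP[].
apply/andP; split.
  apply: integral_ge0 => x _.
  by rewrite lee_fin divr_ge0 ?trunc_sq_ge0 ?powR_ge0.
apply: le_trans ib; apply: ge0_le_integral => //.
- by move=> x _; rewrite lee_fin divr_ge0 ?trunc_sq_ge0 ?powR_ge0.
- apply/measurable_EFinP.
  apply: (@measurable_kernel alpha t0 (fun tau => psi tau ^+ 2)).
  exact: measurable_funX.
- move=> x; rewrite /= in_itv /= => /andP[x0 xt0].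
  rewrite lee_fin ler_wpM2r ?invr_ge0 ?powR_ge0//.
  have wpsi : w x <= psi x.
    rewrite leNgt; apply/negP => psiw.
    have : A x by split; [rewrite x0 (le_trans (ltW xt0))|exact: ltW].
    by move=> /t0A; rewrite leNgt xt0.
  have w1 := trunc_solution_ge1 ws x0.
  rewrite /trunc_sq ge_min lerXn2r// ?nnegrE; lra.
Qed.

(** * Kernel integrals of the two supersolutions *)

Lemma is_derive_powR_sub (t a x : R) : x < t ->
  is_derive x 1 (fun y : R => (t - y) `^ a) (- (a * (t - x) `^ (a - 1))).
Proof.
rewrite -subr_gt0 => tx.
have d : is_derive x 1 (fun y : R => t - y) (-1).
  by apply: is_derive_eq; rewrite add0r mul1r.
have := @is_derive1_comp _ (fun y : R => y `^ a) (fun y => t - y) x _ _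
  (is_derive1_powR a tx) d.
by rewrite mulrN1.
Qed.

Lemma is_derive_inv_sub (A x : R) : x < A ->
  is_derive x 1 (fun y : R => (A - y)^-1) ((A - x) ^- 2).
Proof.
rewrite -subr_gt0 => Ax.
have d : is_derive x 1 (fun y : R => A - y) (-1).
  by apply: is_derive_eq; rewrite add0r mul1r.
have := @is_deriveV _ (fun y : R => A - y) _ _ _ (lt0r_neq0 Ax) d.
by rewrite /GRing.scale /= mulrN1 opprK.
Qed.

(** For the constant supersolution 2. The primitive -(4 / alpha) (t - x)^alpha is nonpositive, so
    the endpoint bound is [L = 0]. *)
Lemma integral_kernel_le (alpha t : R) : 0 < alpha -> 0 <= t ->
  (\int[mu]_(tau in `[0%R, t[)
      (2 ^+ 2 / (t - tau) `^ (1 - alpha))%:E <= (4 / alpha * t `^ alpha)%:E)%E.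
Proof.
move=> a0 t0.
pose F (x : R) := (- (4 / alpha)) *: (t - x) `^ alpha.
have -> : 4 / alpha * t `^ alpha = 0 - F 0.
  by rewrite /F subr0 /GRing.scale /= mulNr sub0r opprK.
have fE : (fun x => 2 ^+ 2 / (t - x) `^ (1 - alpha)) =
    (fun x => 4 *: (t - x) `^ (alpha - 1)).
  by apply/funext => x; rewrite -powRN opprB /GRing.scale /=; congr (_ * _); ring.
apply: (integral_itvco_derive_le t0) => [x /andP[x0 xt]|x /andP[x0 xt]|x _|x _].
- have d := is_derive_powR_sub alpha xt.
  rewrite /F; apply: is_derive_eq.
  rewrite -powRN opprB /GRing.scale /=; field.
  by rewrite gt_eqF.
- have d := is_derive_powR_sub (alpha - 1) xt.
  by rewrite fE; apply: derivableZ; exact: ex_derive.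
- by rewrite divr_ge0 ?powR_ge0 ?sqr_ge0.
- by rewrite /F /GRing.scale /= mulNr oppr_le0 mulr_ge0 ?powR_ge0// divr_ge0 ?ltW.
Qed.

(** Young's inequality for t^a and 1 with exponents [a^-1] and [(1 - a)^-1]: a concave power lies
    below its tangent at 1. *)
Lemma powR_le_tangent (t a : R) : 0 < a -> a < 1 -> 0 <= t ->
  t `^ a / a <= t + a^-1 - 1.
Proof.
move=> a0 a1 t0.
have b0 : 0 < 1 - a by rewrite subr_gt0.
have := @conjugate_powR R (t `^ a) 1 a^-1 (1 - a)^-1 (powR_ge0 _ _) ler01.
rewrite !invr_gt0 => /(_ a0 b0).
rewrite !invrK subrKC => /(_ erefl).
rewrite -powRrM mulfV ?gt_eqF// powRr1// powR1 mulr1 mul1r => h.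
rewrite ler_pdivrMr// !mulrDl mulVf ?gt_eqF//; lra.
Qed.

(** Write the kernel as 1 plus an excess. The 1 contributes exactly [(A - t)^-1 - A^-1]; the excess
    integrates to t^alpha / alpha - t, at most [alpha^-1 - 1], which vanishes as alpha tends to
    1. *)
Lemma integral_blowup_kernel_le (alpha A K t : R) : 0 < alpha -> alpha < 1 ->
  0 <= t -> t <= 1 -> t < A -> (A - t)^-1 <= K ->
  (\int[mu]_(tau in `[0%R, t[)
      ((A - tau)^-1 ^+ 2 / (t - tau) `^ (1 - alpha))%:E
    <= ((A - t)^-1 - A^-1 + K ^+ 2 * (alpha^-1 - 1))%:E)%E.
Proof.
move=> a0 a1 t0 t1 tA AK.
have AtK x : x <= t -> (A - x) ^- 2 <= K ^+ 2.
  move=> xt; have h0 : 0 <= (A - x)^-1 by rewrite invr_ge0; lra.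
  have h : (A - x)^-1 <= K by apply: le_trans AK; rewrite lef_pV2 ?posrE; lra.
  by rewrite -exprVn lerXn2r// nnegrE (le_trans h0).
have kge1 x : 0 <= x < t -> 1 <= (t - x) `^ (alpha - 1).
  move=> /andP[x0 xt]; rewrite -[leLHS](powRr0 (t - x)) ger_powR//; lra.
(* As the kernel is at least 1 and [(A - x)^-1 <= K], [f] dominates the integrand;
   unlike the integrand it has an elementary primitive. *)
pose f x := (A - x) ^- 2 + K ^+ 2 *: ((t - x) `^ (alpha - 1) - 1).
pose F x := (A - x)^-1 - K ^+ 2 *: (alpha^-1 *: (t - x) `^ alpha + x).
have xA x : x < t -> x < A by move=> xt; exact: lt_trans tA.
have df x : 0 <= x < t -> derivable f x 1.
  move=> /andP[x0 xt]; rewrite /f.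
  have d := is_derive_powR_sub (alpha - 1) xt.
  have d' := is_derive_inv_sub (xA _ xt).
  under eq_fun do rewrite -exprVn.
  exact: ex_derive.
have mf : measurable_fun `[0, t[ f.
  apply: subspace_continuous_measurable_fun => //.
  by apply: derivable_within_continuous => x; rewrite in_itv /= => /df.
have mg : measurable_fun `[0, t[ (fun x => (A - x)^-1).
  apply: subspace_continuous_measurable_fun => //.
  apply: derivable_within_continuous => x; rewrite in_itv /= => /andP[x0 xt].
  have d' := is_derive_inv_sub (xA _ xt).
  exact: ex_derive.
have gf x : 0 <= x < t -> (A - x)^-1 ^+ 2 / (t - x) `^ (1 - alpha) <= f x.
  move=> xt; rewrite -powRN opprB exprVn /f /GRing.scale /=.
  have := kge1 _ xt; have := AtK x.
  move: xt => /andP[_ xt] /(_ (ltW xt)) h1 h2.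
  rewrite -subr_ge0.
  suff : 0 <= (K ^+ 2 - (A - x) ^- 2) * ((t - x) `^ (alpha - 1) - 1) by lra.
  by rewrite mulr_ge0// subr_ge0.
have g0 x : 0 <= (A - x)^-1 ^+ 2 / (t - x) `^ (1 - alpha).
  by rewrite divr_ge0 ?sqr_ge0 ?powR_ge0.
apply: (@le_trans _ _ (\int[mu]_(x in `[0%R, t[) (f x)%:E)%E).
  apply: ge0_le_integral => //.
  - by move=> x _; rewrite lee_fin.
  - apply/measurable_EFinP.
    apply: (@measurable_kernel alpha t (fun x => (A - x)^-1 ^+ 2)).
    exact: measurable_funX.
  - exact/measurable_EFinP.
(* The terms before [F 0] are the value of [F] at [t], where the power vanishes. They bound [F] on
   the whole interval because t - x is at most (t - x)^alpha / alpha. *)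
apply: (@le_trans _ _ ((A - t)^-1 - K ^+ 2 * t - F 0)%:E).
  apply: integral_itvco_derive_le => //.
  - move=> x /andP[x0 xt]; rewrite /F /f.
    have d := is_derive_powR_sub alpha xt.
    have d' := is_derive_inv_sub (xA _ xt).
    apply: is_derive_eq; rewrite /GRing.scale /=.
    by rewrite mulrN mulrA mulVf ?gt_eqF// mul1r; ring.
  - by move=> x xt; apply: le_trans (gf _ xt).
  - move=> x /andP[x0 xt]; rewrite /F /GRing.scale /=.
    have tx0 : 0 <= t - x by rewrite subr_ge0.
    have h1 : (A - x)^-1 <= (A - t)^-1 by rewrite lef_pV2 ?posrE; lra.
    have h2 : t - x <= alpha^-1 * (t - x) `^ alpha.
      apply: (@le_trans _ _ ((t - x) `^ alpha)); last first.
        by rewrite ler_peMl ?powR_ge0// invf_ge1// ltW.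
      move: tx0; rewrite le_eqVlt => /predU1P[<-|tx0]; first exact: powR_ge0.
      by apply: ger1_powR; [lra|exact: ltW].
    have : K ^+ 2 * (t - x) <= K ^+ 2 * (alpha^-1 * (t - x) `^ alpha).
      by rewrite ler_wpM2l ?sqr_ge0.
    lra.
rewrite lee_fin /F /GRing.scale /= !subr0 addr0.
have := powR_le_tangent a0 a1 t0.
rewrite mulrC => h.
suff : K ^+ 2 * (alpha^-1 * t `^ alpha) <= K ^+ 2 * (t + alpha^-1 - 1) by lra.
by rewrite ler_wpM2l ?sqr_ge0.
Qed.

(** * Lower bounds for the blow-up time from each supersolution *)

Lemma le_blowup_time (w : nat -> R -> R) (T K : R) : 0 < T ->
  (forall M t, (4 <= M)%N -> 0 <= t <= T -> w M t <= K) ->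
  (T%:E <= blowup_time (sup_solution w))%E.
Proof.
move=> T0 wK; apply: ereal_sup_ubound; split; first by rewrite lte_fin.
move=> T1 _; rewrite lte_fin => T1T; apply: (@le_lt_trans _ _ K%:E); last exact: ltry.
apply: ge_ereal_sup => _ [t /andP[t0 tT1] <-].
apply: ge_ereal_sup => _ [M M4 <-].
by rewrite lee_fin wK// t0 (le_trans tT1)// ltW.
Qed.

(** The constant 2 works as long as 4 T^alpha / (alpha Gamma(alpha)) < 1. The linear bound on 1 /
    Gamma cancels alpha, and this choice of T makes the quantity at most 1/2. *)
Lemma blowup_time_ge_small_alpha (alpha : R) (w : nat -> R -> R) :
  0 < alpha ->
  (forall M : nat, (4 <= M)%N -> is_trunc_solution alpha M (w M)) ->
  (((16 * expR 1)^-1 `^ alpha^-1)%:E <= blowup_time (sup_solution w))%E.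
Proof.
move=> a0 ws; set T := _ `^ _.
have L0 : 0 < 16 * expR 1 :> R by rewrite mulr_gt0// expR_gt0.
have T0 : 0 < T by rewrite powR_gt0// invr_gt0.
have Ta : T `^ alpha = (16 * expR 1)^-1.
  by rewrite -powRrM mulVf ?gt_eqF// powRr1// invr_ge0 ltW.
apply: (@le_blowup_time _ _ 2 T0) => M t M4 tT; apply: ltW.
apply: (trunc_solution_lt (ws M M4) (psi := fun=> 2) _ _ tT).
  by apply: continuous_subspaceT => x; exact: cvg_cst.
move=> {}t {tT} /andP[t0 tT]; exists (4 / alpha * t `^ alpha).
  exact: integral_kernel_le.
have ta : t `^ alpha <= (16 * expR 1)^-1.
  by rewrite -Ta ge0_ler_powR ?nnegrE ?(ltW a0) ?(ltW T0).
have h0 : 0 <= 4 / alpha * t `^ alpha by rewrite mulr_ge0 ?powR_ge0 ?divr_ge0 ?ltW.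
have h : (Gamma alpha)^-1 * (4 / alpha * t `^ alpha) <=
    2 * expR 1 * alpha * (4 / alpha * (16 * expR 1)^-1).
  apply: (le_trans (ler_wpM2r h0 (Gamma_inv_le_linear a0))).
  rewrite ler_wpM2l ?mulr_ge0 ?expR_ge0 ?(ltW a0)//.
  by rewrite ler_wpM2l ?divr_ge0 ?(ltW a0).
have e : 2 * expR 1 * alpha * (4 / alpha * (16 * expR 1)^-1) = 2^-1.
  by field; rewrite !gt_eqF ?expR_gt0.
move: h; rewrite e; lra.
Qed.

(** Up to time 1 - 2 rho the supersolution 1 / (1 - rho - t) stays below K = 1 / rho. Since alpha is
    at least 1/2, [alpha^-1 - 1] is at most rho^3, so the kernel excess costs at most K^2 rho^3 =
    rho. *)
Lemma blowup_time_ge_near1 (alpha rho : R) (w : nat -> R -> R) :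
  0 < rho -> rho < 4^-1 -> alpha < 1 -> 1 - alpha <= rho ^+ 3 / 2 ->
  (forall M : nat, (4 <= M)%N -> is_trunc_solution alpha M (w M)) ->
  ((1 - 2 * rho)%:E <= blowup_time (sup_solution w))%E.
Proof.
move=> r0 r4 a1 ar ws.
have r2 : rho ^+ 2 < 1 by rewrite expr_lt1 ?ltW//; lra.
have r3 : rho ^+ 3 <= rho ^+ 2 by rewrite exprS ler_piMl ?sqr_ge0//; lra.
have a2 : 2^-1 <= alpha by lra.
have a0 : 0 < alpha by lra.
have aV : alpha^-1 - 1 <= rho ^+ 3.
  have -> : alpha^-1 - 1 = (1 - alpha) / alpha by field; rewrite gt_eqF.
  rewrite ler_pdivrMr//; have : rho ^+ 3 * 2^-1 <= rho ^+ 3 * alpha.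
    by rewrite ler_wpM2l// exprn_ge0 ?ltW.
  lra.
have KV : rho^-1 ^+ 2 * (alpha^-1 - 1) <= rho.
  rewrite exprVn mulrC ler_pdivrMr ?exprn_gt0//; exact: (le_trans aV).
have psi_le t : 0 <= t <= 1 - 2 * rho -> (1 - rho - t)^-1 <= rho^-1.
  by move=> /andP[t0 tT]; rewrite lef_pV2 ?posrE; lra.
have T0 : 0 < 1 - 2 * rho by lra.
apply: (@le_blowup_time _ _ rho^-1 T0) => M t M4 tT.
apply: le_trans (psi_le _ tT); apply: ltW.
apply: (trunc_solution_lt (ws M M4) (psi := fun t => (1 - rho - t)^-1) _ _ tT).
  apply: derivable_within_continuous => x; rewrite in_itv /= => /andP[x0 xT].
  have d : is_derive x 1 (fun y : R => (1 - rho - y)^-1) ((1 - rho - x) ^- 2).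
    by apply: is_derive_inv_sub; lra.
  exact: ex_derive.
move=> {}t {}tT; have /andP[t0 tle] := tT.
exists ((1 - rho - t)^-1 - (1 - rho)^-1 + rho^-1 ^+ 2 * (alpha^-1 - 1)).
  by apply: integral_blowup_kernel_le => //; [lra|lra|exact: psi_le].
(* The slack strictly exceeds the cost [rho] of the excess, which makes the supersolution strict. *)
have rV : 1 + rho < (1 - rho)^-1.
  rewrite -[ltRHS]div1r ltr_pdivlMr; last lra.
  have : 0 < rho ^+ 2 by rewrite exprn_gt0.
  lra.
set b := (X in _ * X).
have b0 : 0 <= b.
  apply: addr_ge0; first by rewrite subr_ge0 lef_pV2 ?posrE; lra.
  by rewrite mulr_ge0 ?sqr_ge0// subr_ge0 invf_ge1// ltW.
have : (Gamma alpha)^-1 * b <= b by rewrite ler_piMl// Gamma_inv_le1.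
rewrite /b; lra.
Qed.

End integrals.

(** * Choice of the constant and the two ranges of [alpha] *)

Theorem theorem1p6 (R : realType) (delta : R) (hdelta : 0 < delta) :
  exists2 c : R, 0 < c &
    forall (alpha : R) (w : nat -> R -> R),
      0 < alpha -> alpha < 1 ->
      (forall M : nat, (4 <= M)%N -> is_trunc_solution alpha M (w M)) ->
      ((c `^ ((1 - alpha) / alpha) / (1 + delta)
          * (1 / Gamma (2 - alpha)) `^ (1 / alpha))%:E
        <= blowup_time (sup_solution w))%E.
Proof.
(* Chosen so that (1 - 4 rho) (1 + delta) = 1, where 1 - 4 rho is a lower bound for (1 - 2 rho) (1 -
   rho)^2. *)
pose rho : R := delta / (4 * (1 + delta)).
have d1 : 0 < 1 + delta by lra.
have r0 : 0 < rho by rewrite divr_gt0// mulr_gt0.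
have rd : 4 * rho * (1 + delta) = delta.
  by rewrite /rho; field; rewrite gt_eqF.
have r4 : rho < 4^-1.
  rewrite /rho ltr_pdivrMr ?mulr_gt0//; lra.
(* Turns the factor 1 - 2 e of the bound on 1 / Gamma into 1 - rho. *)
pose e : R := rho / 2.
have e0 : 0 < e by rewrite divr_gt0.
pose eta : R := rho ^+ 3 / 2.
have eta0 : 0 < eta by rewrite divr_gt0// exprn_gt0.
have r2 : rho ^+ 2 < 1 by rewrite expr_lt1 ?ltW//; lra.
have r3 : rho ^+ 3 <= rho ^+ 2 by rewrite exprS ler_piMl ?sqr_ge0//; lra.
have eta1 : eta <= 1 by rewrite /eta; lra.
pose L : R := 16 * expR 1.
have L1 : 1 <= L.
  by have := expR_ge1Dx (1 : R); rewrite /L; lra.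
(* With [c] the power of [c0] such that c^eta = c0, any s > eta gives c^s <= c0, small enough to
   beat 1 / L; [c] also stays below [e]. *)
pose c0 : R := e * (2 * L)^-1.
have c00 : 0 < c0 by rewrite mulr_gt0// invr_gt0; lra.
have c0e : c0 <= e.
  by rewrite /c0 ler_piMr ?(ltW e0)// invf_le1; lra.
pose c : R := c0 `^ eta^-1.
have c_gt0 : 0 < c by rewrite powR_gt0.
have c_le : c <= c0.
  by apply: ge1r_powR; [rewrite /e in c0e; lra|rewrite invf_ge1].
have c_eta : c `^ eta = c0.
  by rewrite -powRrM mulVf ?gt_eqF// powRr1// ltW.
exists c => // alpha w a0 a1 ws.
set s := 1 - alpha.
have s0 : 0 < s by rewrite subr_gt0.
(* The claimed bound is X^(1 / alpha) / (1 + delta), so it suffices to estimate [X]. *)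
pose X := c `^ s * (Gamma (2 - alpha))^-1.
have X0 : 0 <= X by rewrite mulr_ge0 ?powR_ge0 ?invr_ge0 ?Gamma_ge0.
have -> : c `^ (s / alpha) / (1 + delta) * (1 / Gamma (2 - alpha)) `^ (1 / alpha)
    = X `^ alpha^-1 / (1 + delta).
  rewrite !div1r powRrM /X powRM ?powR_ge0 ?invr_ge0 ?Gamma_ge0//.
  by rewrite mulrAC.
have GV : (Gamma (2 - alpha))^-1 <= (e `^ s * (1 - rho))^-1.
  have := @Gamma_inv_le_powR R (2 - alpha) e.
  have -> : 2 - alpha - 1 = s by rewrite /s; ring.
  have -> : 2 * e = rho by rewrite /e; field.
  by apply; rewrite /e; lra.
have XG : X <= c `^ s * (e `^ s * (1 - rho))^-1.
  by rewrite ler_wpM2l ?powR_ge0.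
have es0 : 0 < e `^ s by rewrite powR_gt0.
have [near|far] := leP s eta.
  (* As c <= e, the powers c^s and e^s cancel and X <= 1 / (1 - rho); since 1 / alpha <= 2, this
     enters at most squared. *)
  apply: le_trans (blowup_time_ge_near1 r0 r4 a1 near ws); rewrite lee_fin.
  have X1 : X <= (1 - rho)^-1.
    have ce : c `^ s <= e `^ s.
      rewrite ge0_ler_powR ?nnegrE ?(ltW s0) ?(ltW c_gt0) ?(ltW e0)//.
      exact: le_trans c0e.
    apply: (le_trans XG).
    have -> : (1 - rho)^-1 = e `^ s * (e `^ s * (1 - rho))^-1.
      by field; rewrite !gt_eqF//; lra.
    by rewrite ler_wpM2r// invr_ge0 mulr_ge0 ?(ltW es0)//; lra.
  have aV2 : alpha^-1 <= 2.
    rewrite -[leRHS]invrK lef_pV2 ?posrE//.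
    by move: near; rewrite /s /eta; lra.
  have h : X `^ alpha^-1 <= (1 - rho)^-1 ^+ 2.
    apply: (@le_trans _ _ ((1 - rho)^-1 `^ alpha^-1)).
      by rewrite ge0_ler_powR ?nnegrE ?invr_ge0 ?(ltW a0)//; lra.
    rewrite -powR_mulrn ?invr_ge0; last lra.
    by rewrite ler_powR// invf_ge1; lra.
  rewrite ler_pdivrMr//; apply: (le_trans h).
  have rho1 : 0 < 1 - rho by lra.
  rewrite exprVn -[leLHS]div1r ler_pdivrMr ?exprn_gt0//.
  have h1 : 1 - 4 * rho <= (1 - 2 * rho) * (1 - rho) ^+ 2.
    have : 0 <= rho ^+ 2 * (5 - 2 * rho) by rewrite mulr_ge0 ?sqr_ge0//; lra.
    lra.
  have : (1 - 4 * rho) * (1 + delta) <= (1 - 2 * rho) * (1 - rho) ^+ 2 * (1 + delta).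
    by rewrite ler_wpM2r// ltW.
  lra.
(* Here c^s <= c0, e^s >= e because s <= 1, and 1 - rho >= 1/2, so X <= 2 c0 / e = 1 / L. *)
apply: le_trans (blowup_time_ge_small_alpha a0 ws); rewrite lee_fin.
have X1 : X <= L^-1.
  apply: (le_trans XG).
  have cs : c `^ s <= c0.
    rewrite -c_eta ger_powR ?(ltW far)// c_gt0.
    by apply: (le_trans c_le); apply: (le_trans c0e); rewrite /e; lra.
  have es : e <= e `^ s.
    by apply: ger1_powR; rewrite /s /e; lra.
  have h : (e `^ s * (1 - rho))^-1 <= (e * 2^-1)^-1.
    have h' : e * 2^-1 <= e `^ s * (1 - rho).
      by apply: ler_pM => //; [exact: ltW|lra].
    have p1 : 0 < e * 2^-1 by lra.
    by rewrite lef_pV2 ?posrE// (lt_le_trans p1).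
  have -> : L^-1 = c0 * (e * 2^-1)^-1.
    by rewrite /c0; field; rewrite !gt_eqF//; lra.
  by apply: ler_pM => //; rewrite ?powR_ge0// invr_ge0 mulr_ge0 ?(ltW es0)//; lra.
apply: (@le_trans _ _ (X `^ alpha^-1)).
  rewrite ler_pdivrMr// ler_peMr ?powR_ge0//; lra.
by rewrite ge0_ler_powR ?nnegrE ?invr_ge0 ?(ltW a0)//; lra.
Qed.
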